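(* Let $\{W_n\}_{n=1}^N$ be subspaces of $\mathbb{R}^M$. The following are equivalent: (a) $\{W_n\}_{n=1}^N$ allows phase retrieval for $\mathbb{R}^M$. (b) For every choice, for each $n=1,\dots,N$, of mutually orthogonal subspaces $\{Z_{n,d}\}_{d=1}^{D_n}$ with $\bigoplus_{d=1}^{D_n}Z_{n,d}=W_n$, the family of subspaces $\{Z_{n,d}\}_{n=1,\,d=1}^{N,\ D_n}$ allows phase retrieval in $\mathbb{R}^M$.
   Context: Given a finite family of subspaces $\{V_i\}_{i\in S}$ of $\mathbb{R}^M$ with orthogonal projections $P_i:\mathbb{R}^M\to V_i$, one says that $\{V_i\}_{i\in S}$ allows phase retrieval in (or for) $\mathbb{R}^M$ if the map $\mathcal{A}:\mathbb{R}^M/\{\pm1\}\to\mathbb{R}^S$, $\mathcal{A}(x)(i)=\|P_ix\|^2$, is injective; that is, whenever $x,y\in\mathbb{R}^M$ satisfy $\|P_ix\|=\|P_iy\|$ for all $i\in S$, then $x=y$ or $x=-y$. In (b), the numbers $D_n\ge 1$ of pieces are also arbitrary. *)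

(* Defs.v *)
From HB Require Import structures.
From mathcomp Require Import all_boot all_order all_algebra.
From mathcomp Require Import sesquilinear.
From mathcomp Require Import reals.

Set Implicit Arguments.
Unset Strict Implicit.
Unset Printing Implicit Defensive.

Import Order.TTheory GRing.Theory Num.Theory.
Local Open Scope ring_scope.

Section PhaseRetrieval.
Variables (R : rcfType) (M : nat).
Implicit Types (x y : 'rV[R]_M) (U V W : {vspace 'rV[R]_M}).

Definition dot x y : R := \sum_(i < M) x 0 i * y 0 i.

Fact dot_bilinear :
  bilinear_for
    (GRing.Scale.Law.clone _ _ ( *%R ) _)
    (GRing.Scale.Law.clone _ _ (idfun \; *%R ) _)
    dot.
Proof.
split=> [u|u] a x y /=; rewrite /dot mulr_sumr -big_split /=.
- by apply: eq_bigr => i _; rewrite !mxE mulrDl mulrA.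
- by apply: eq_bigr => i _; rewrite !mxE mulrDr mulrCA.
Qed.

HB.instance Definition _ :=
  bilinear_isBilinear.Build R _ _ _
    (GRing.Scale.Law.clone _ _ ( *%R ) _)
    (GRing.Scale.Law.clone _ _ (idfun \; *%R ) _)
    dot dot_bilinear.

Fact dot_hermitian x y : dot x y = (-1) ^+ false * idfun (dot y x).
Proof. by rewrite expr0 mul1r; apply: eq_bigr => i _; rewrite mulrC. Qed.

HB.instance Definition _ :=
  @isHermitianSesquilinear.Build R _ false idfun dot dot_hermitian.

Fact dot_gt0 x : x != 0 -> 0 < dot x x.
Proof.
move=> x0; rewrite lt_neqAle sumr_ge0 ?andbT => [|i _]; last by rewrite -expr2 sqr_ge0.
apply: contra x0; rewrite eq_sym psumr_eq0 => [/allP x0|i _]; last first.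
  by rewrite -expr2 sqr_ge0.
apply/eqP/rowP => i; rewrite mxE; apply/eqP.
by have := x0 i (mem_index_enum i); rewrite /= mulf_eq0 orbb.
Qed.

HB.instance Definition _ := isDotProduct.Build R _ dot dot_gt0.

(* The Euclidean norm. The norm `|x| that the libraries put on row vectors
   is the sup norm, hence this definition. *)
Definition enorm x : R := Num.sqrt (dot x x).

Definition orthocompl U : {vspace 'rV[R]_M} := orthov dot U.

(* [daddv_pi U V] is the projection onto U along V. *)
Definition orthoproj U : 'End('rV[R]_M) := daddv_pi U (orthocompl U).

Lemma orthoproj_mem U x : orthoproj U x \in U.
Proof. exact: memv_pi. Qed.

Lemma capv_orthocompl U : (U :&: orthocompl U = 0)%VS.
Proof.
apply/eqP; rewrite -subv0; apply/subvP => u; rewrite memv_cap memv0.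
case/andP=> uU /mem_orthovP/(_ u uU) uu0; apply: contraT => /dot_gt0.
by rewrite [dot u u]uu0 ltxx.
Qed.

Lemma dim_orthocompl_span (s : seq 'rV[R]_M) :
  (\dim {:'rV[R]_M} <= size s + \dim (orthocompl <<s>>))%N.
Proof.
elim: s => [|u s IHs]; first by rewrite span_nil /orthocompl orthov0.
have -> : orthocompl <<u :: s>> = (orthocompl <<s>> :&: orthov dot <[u]>)%VS.
  apply/eqP; rewrite span_cons eqEsubv subv_cap -!orthovD addvC subvv /=.
  by rewrite orthovD capvSl capvSr.
apply: leq_trans IHs _; rewrite /= addSnnS leq_add2l.
by rewrite (leq_trans (leqSpred _))// ltnS; exact: (leq_dim_orthov1 dot).
Qed.

Lemma addv_orthocompl U : (U + orthocompl U = fullv)%VS.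
Proof.
apply/eqP; rewrite eqEdim subvf dimv_disjoint_sum ?capv_orthocompl//=.
have := dim_orthocompl_span (vbasis U).
by rewrite (span_basis (vbasisP U)) size_tuple.
Qed.

Lemma sub_orthoproj U x : x - orthoproj U x \in orthocompl U.
Proof.
rewrite -{1}[x](daddv_pi_add (capv_orthocompl U)) ?addv_orthocompl ?memvf//.
by rewrite addrC addKr memv_pi.
Qed.

Definition allows_phase_retrieval (S : finType) (V : S -> {vspace 'rV[R]_M}) :=
  forall x y,
    (forall i : S, enorm (orthoproj (V i) x) = enorm (orthoproj (V i) y)) ->
    x = y \/ x = - y.

Definition orthogonal_decomposition (D : nat)
    (Z : 'I_D -> {vspace 'rV[R]_M}) W : Prop :=
  [/\ forall d e : 'I_D, d != e ->
        {in Z d & Z e, forall x y, dot x y = 0},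
      directv (\sum_(d < D) Z d)
    & (\sum_(d < D) Z d)%VS = W].

End PhaseRetrieval.

(* Main.v *)
Require Import Defs.
From mathcomp Require Import all_boot all_order all_algebra reals.
From mathcomp Require Import sesquilinear.
Local Open Scope ring_scope.
Import GRing.Theory Num.Theory.

(** For orthogonal pieces Z_1, .., Z_D of W the projection onto W is the sum of
    the projections onto the Z_d, so the Pythagorean theorem writes the squared
    norm of the projection of x onto W as the sum of the squared norms of its
    projections onto the Z_d ([dot_orthoproj_decomposition]).  The measurements
    against the pieces therefore determine those against W, so two vectors that the
    pieces do not tell apart are not told apart by the W_n either, and agree up
    to sign.
    Conversely, each W_n is the only piece of a decomposition of itself. *)

Section OrthogonalProjections.
Context {R : rcfType} {M : nat}.
Implicit Types (x p : 'rV[R]_M) (U W : {vspace 'rV[R]_M}).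

(** The difference of p and the projection lies both in U and in its
    orthogonal complement, so it vanishes. *)
Lemma orthoproj_unique U x p :
  p \in U -> x - p \in orthocompl U -> orthoproj U x = p.
Proof.
move=> pU xpU; apply/eqP; rewrite -subr_eq0 -memv0 -(capv_orthocompl U).
rewrite memv_cap rpredB ?orthoproj_mem//=.
have -> : orthoproj U x - p = (x - p) - (x - orthoproj U x).
  by rewrite opprB [RHS]addrC addrA subrK.
by rewrite rpredB ?sub_orthoproj.
Qed.

Lemma dot_orthocompl U x u : u \in U -> x \in orthocompl U -> dot x u = 0.
Proof. by move=> uU /mem_orthovP; apply. Qed.

(** Self-adjointness and idempotence of orthogonal projections in one formula:
    the squared norm of the projection becomes linear in it, and hence additive
    when projections of the same vector are summed. *)
Lemma dot_orthoproj_self U x :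
  dot x (orthoproj U x) = dot (orthoproj U x) (orthoproj U x).
Proof.
apply/eqP; rewrite -subr_eq0 -linearBl; apply/eqP.
exact: dot_orthocompl (orthoproj_mem U x) (sub_orthoproj U x).
Qed.

(** The sum lies in W, and the residual is orthogonal to each piece, hence to
    W: these two properties characterize the projection. *)
Lemma orthoproj_decomposition {D : nat} {Z : 'I_D -> {vspace 'rV[R]_M}} {W} x :
  orthogonal_decomposition Z W ->
  orthoproj W x = \sum_(d < D) orthoproj (Z d) x.
Proof.
case=> orthZ _ <-; apply: orthoproj_unique.
  by apply: memv_sumr => d _; exact: orthoproj_mem.
apply/mem_orthovP => _ /memv_sumP[z zZ ->] /=.
rewrite linear_sumr big1//= => e _.
(* Against [z e], only the projection onto the piece containing it counts. *)
rewrite (bigD1 e)//= opprD addrA linearBl/= linear_sumlz/=.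
rewrite (dot_orthocompl _ _ _ (zZ e isT) (sub_orthoproj _ _)) big1 ?subr0//.
by move=> d de; apply: (orthZ d e); rewrite ?orthoproj_mem ?zZ.
Qed.

Lemma dot_orthoproj_decomposition {D : nat} {Z : 'I_D -> {vspace 'rV[R]_M}} {W} x :
  orthogonal_decomposition Z W ->
  dot (orthoproj W x) (orthoproj W x) =
  \sum_(d < D) dot (orthoproj (Z d) x) (orthoproj (Z d) x).
Proof.
move=> ZW; rewrite -dot_orthoproj_self (orthoproj_decomposition x ZW).
by rewrite linear_sumr; apply: eq_bigr => d _; exact: dot_orthoproj_self.
Qed.

Lemma enorm_eq_dot (x y : 'rV[R]_M) : enorm x = enorm y <-> dot x x = dot y y.
Proof.
have dot_ge0 (z : 'rV[R]_M) : 0 <= dot z z.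
  by rewrite sumr_ge0// => i _; rewrite -expr2 sqr_ge0.
split=> [exy|]; last by rewrite /enorm => ->.
by rewrite -(sqr_sqrtr (dot_ge0 x)) -(sqr_sqrtr (dot_ge0 y)); congr (_ ^+ 2).
Qed.

Lemma orthogonal_decomposition1 W : orthogonal_decomposition (fun _ : 'I_1 => W) W.
Proof.
split=> [d e||]; first by rewrite !ord1.
  by apply/directv_sum_independent => u _; rewrite big_ord1 => u0 i _; rewrite ord1.
by rewrite big_ord1.
Qed.

End OrthogonalProjections.

Theorem corollary3p6 (R : realType) (M N : nat)
    (W : 'I_N -> {vspace 'rV[R]_M}) :
  allows_phase_retrieval W
  <->
  (forall D : 'I_N -> nat, (forall n : 'I_N, (1 <= D n)%N) ->
   forall Z : forall n : 'I_N, 'I_(D n) -> {vspace 'rV[R]_M},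
     (forall n : 'I_N, orthogonal_decomposition (Z n) (W n)) ->
     allows_phase_retrieval
       (fun nd : {n : 'I_N & 'I_(D n)} => Z (tag nd) (tagged nd))).
Proof.
split=> [prW D _ Z ZW x y eqZ|prZ x y eqW].
  apply: prW => n; apply/enorm_eq_dot.
  rewrite !(dot_orthoproj_decomposition _ (ZW n)).
  apply: eq_bigr => d _; apply/enorm_eq_dot.
  exact: eqZ (Tagged (fun n => 'I_(D n)) d).
apply: (prZ (fun=> 1) (fun=> isT) (fun n _ => W n)) => [n|nd].
  exact: orthogonal_decomposition1.
exact: eqW.
Qed.
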